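(* A Banach space $E$ is Fra\''iss\'e if and only if it is approximately ultrahomogeneous and $\omega$-categorical.
   Context: For Banach spaces $X,E$ and $\delta\ge 0$, a $\delta$-isometry from $X$ to $E$ is a linear map $T\colon X\to E$ with $\frac{1}{1+\delta}\|x\|\le\|Tx\|\le(1+\delta)\|x\|$ for all $x\in X$. $\mathrm{Emb}(X,E)$ (resp. $\mathrm{Emb}_\delta(X,E)$) is the set of linear isometries (resp. $\delta$-isometries) from $X$ into $E$; $\mathrm{Isom}(E)$ is the group of surjective linear isometries of $E$. $\mathrm{Age}(E)$ is the set of finite-dimensional subspaces of $E$, and $\mathrm{Age}_k(E)$ the set of $k$-dimensional subspaces. $E$ is Fra\''iss\'e if for every $\varepsilon>0$ and every $k\in\mathbb N$ there is $\delta>0$ such that if $X\in\mathrm{Age}_k(E)$ and $\phi,\psi\in\mathrm{Emb}_\delta(X,E)$, then there exists $T\in\mathrm{Isom}(E)$ with $\|T\circ\phi-\psi\|<\varepsilon$. $E$ is approximately ultrahomogeneous if for every $X\in\mathrm{Age}(E)$, every $\varepsilon>0$ and all $\phi,\psi\in\mathrm{Emb}(X,E)$ there exists $T\in\mathrm{Isom}(E)$ with $\|T\circ\phi-\psi\|<\varepsilon$. For $n\in\mathbb N$, let $S_E$ be the unit sphere of $E$; $\mathrm{Isom}(E)$ acts on $S_E^n$ by $T\cdot(x_1,\dots,x_n)=(Tx_1,\dots,Tx_n)$. With the $\ell_2$-sum norm on $E^n$, define the pseudometric $d(x,y)=\inf_{T\in\mathrm{Isom}(E)}\|Tx-y\|$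 on $S_E^n$, let $Q_n$ be the quotient of $S_E^n$ by the relation $d(x,y)=0$, and let $\tilde d$ be the metric induced by $d$ on $Q_n$. $E$ is $\omega$-categorical if $(Q_n,\tilde d)$ is compact for every $n\in\mathbb N$. *)

(* Defs.v *)
From HB Require Import structures.
From mathcomp Require Import all_boot all_order all_algebra.
From mathcomp Require Import all_classical all_reals all_analysis.
From mathcomp.real_closed Require Import complex.

Set Implicit Arguments.
Unset Strict Implicit.
Unset Printing Implicit Defensive.

Import Order.TTheory GRing.Theory Num.Theory.
Import numFieldNormedType.Exports.

Local Open Scope classical_set_scope.
Local Open Scope ring_scope.

Inductive scalar_kind := RealScalars | ComplexScalars.

Definition scalar_field (R : realType) (F : scalar_kind) : numFieldType :=
  match F with
  | RealScalars => R
  | ComplexScalars => (R[i])%C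
  end.

(* MathComp norms on a K-normed space take their values in K, also for
   K = R[i]; they are brought back to R by taking the real part. *)
Definition real_part (R : realType) (F : scalar_kind) : scalar_field R F -> R :=
  match F with
  | RealScalars => id
  | ComplexScalars => @complex.Re R
  end.

Definition rnorm (R : realType) (F : scalar_kind)
  (V : normedModType (scalar_field R F)) (x : V) : R := real_part `|x|.

Section rnorm_theory.
Context (R : realType) (F : scalar_kind) (V : normedModType (scalar_field R F)).
Implicit Types x y : V.

Let real_part_le (a b : scalar_field R F) : a <= b -> real_part a <= real_part b.
Proof. by case: F a b => //= a b; rewrite lecE => /andP[]. Qed.

Let real_partD (a b : scalar_field R F) :
  real_part (a + b) = real_part a + real_part b.
Proof. by case: F a b => //= -[? ?] [? ?]. Qed.

Let real_part0 : real_part (0 : scalar_field R F) = 0.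
Proof. by case: F. Qed.

Lemma rnorm_ge0 x : 0 <= rnorm x.
Proof. by rewrite -real_part0; apply: real_part_le. Qed.

Lemma rnorm0 : rnorm (0 : V) = 0.
Proof. by rewrite /rnorm normr0 real_part0. Qed.

Lemma ler_rnormD x y : rnorm (x + y) <= rnorm x + rnorm y.
Proof. by rewrite -real_partD; apply/real_part_le/ler_normD. Qed.

Lemma rnormN x : rnorm (- x) = rnorm x.
Proof. by rewrite /rnorm normrN. Qed.

Lemma rnorm_eq0 x : rnorm x = 0 -> x = 0.
Proof.
rewrite /rnorm => x0; apply/normr0_eq0.
have : 0 <= `|x| by [].
case: F V x x0 => //= W x; case: (`|x|) => a b /= ->.
by rewrite lecE /= => /andP[/eqP -> _].
Qed.

End rnorm_theory.

Section embeddings.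
Context (R : realType) (F : scalar_kind).
Local Notation K := (scalar_field R F).
Implicit Types V W E : normedModType K.

Definition lin_indep V k (b : 'I_k -> V) : Prop :=
  forall c : 'I_k -> K, \sum_i c i *: b i = 0 -> forall i, c i = 0.

Definition lin_span V k (b : 'I_k -> V) : set V :=
  [set x | exists c : 'I_k -> K, x = \sum_i c i *: b i].

Definition Age_ V (k : nat) : set (set V) :=
  [set X | exists2 b : 'I_k -> V, lin_indep b & X = lin_span b].
Arguments Age_ : clear implicits.

Definition Age V : set (set V) := \bigcup_k Age_ V k.
Arguments Age : clear implicits.

(* A linear map from a subspace X of V to W is represented by a function
   V -> W of which only the restriction to X is ever constrained or used. *)
Definition linear_on V W (X : set V) (f : V -> W) : Prop :=
  forall (a : K) x y, X x -> X y -> f (a *: x + y) = a *: f x + f y.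

Definition Emb V W (X : set V) : set (V -> W) :=
  [set f | linear_on X f /\ forall x, X x -> rnorm (f x) = rnorm x].

Definition Emb_ (delta : R) V W (X : set V) : set (V -> W) :=
  [set f | linear_on X f /\ forall x, X x ->
    (1 + delta)^-1 * rnorm x <= rnorm (f x) <= (1 + delta) * rnorm x].

Definition Isom E : set {linear E -> E} :=
  [set T | (forall x, rnorm (T x) = rnorm x) /\ forall y, exists x, T x = y].

(* Operator norm of the restriction of f to X. The real supremum is the actual
   one: below, f is always linear on a finite-dimensional subspace X, hence
   bounded on the unit ball of X. *)
Definition opnorm V W (X : set V) (f : V -> W) : R :=
  sup [set rnorm (f x) | x in X `&` [set x | rnorm x <= 1]].

Definition fraisse E : Prop :=
  forall (eps : R) (k : nat), 0 < eps ->
  exists2 delta : R, 0 < delta &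
    forall X : set E, Age_ E k X ->
    forall phi psi : E -> E, Emb_ delta X phi -> Emb_ delta X psi ->
    exists2 T : {linear E -> E}, Isom T & opnorm X ((T \o phi) \- psi) < eps.

Definition approximately_ultrahomogeneous E : Prop :=
  forall X : set E, Age E X ->
  forall eps : R, 0 < eps ->
  forall phi psi : E -> E, Emb X phi -> Emb X psi ->
  exists2 T : {linear E -> E}, Isom T & opnorm X ((T \o phi) \- psi) < eps.

End embeddings.

Arguments Age_ {R F} V k.
Arguments Age {R F} V.

Section orbit_space.
Context (R : realType) (F : scalar_kind) (E : normedModType (scalar_field R F)).
Variable n : nat.
Local Notation Isom := (@Isom R F E).
Local Notation En := {ffun 'I_n -> E}.
Implicit Types (T : {linear E -> E}) (x y z : En).

Definition l2norm x : R := Num.sqrt (\sum_i rnorm (x i) ^+ 2).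

Definition unit_sphere : set E := [set x | rnorm x = 1].

Definition sphere_pow : set En := [set x | forall i, unit_sphere (x i)].

Definition act T x : En := [ffun i => T (x i)].

Definition orbit_dist x y : R :=
  inf [set l2norm (act T x - y) | T in Isom].

Let l2norm_ge0 x : 0 <= l2norm x.
Proof. exact: sqrtr_ge0. Qed.

Let l2normN x : l2norm (- x) = l2norm x.
Proof.
by congr Num.sqrt; apply: eq_bigr => i _; rewrite !ffunE rnormN.
Qed.

Let cauchy_schwarz (a b : 'I_n -> R) :
  (forall i, 0 <= a i) -> (forall i, 0 <= b i) ->
  \sum_i a i * b i <=
    Num.sqrt (\sum_i a i ^+ 2) * Num.sqrt (\sum_i b i ^+ 2).
Proof.
move=> a0 b0.
have S0 (c : 'I_n -> R) : 0 <= \sum_i c i ^+ 2.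
  by apply: sumr_ge0 => i _; exact: sqr_ge0.
set A : R := Num.sqrt (\sum_i a i ^+ 2).
set B : R := Num.sqrt (\sum_i b i ^+ 2).
have A2 : A ^+ 2 = \sum_i a i ^+ 2 by rewrite sqr_sqrtr.
have B2 : B ^+ 2 = \sum_i b i ^+ 2 by rewrite sqr_sqrtr.
have A0 : 0 <= A by exact: sqrtr_ge0.
have B0 : 0 <= B by exact: sqrtr_ge0.
have zero (c : 'I_n -> R) : Num.sqrt (\sum_i c i ^+ 2) = 0 ->
    forall i, c i = 0.
  move=> /eqP; rewrite sqrtr_eq0 => c0 i; apply/eqP; rewrite -sqrf_eq0.
  rewrite eq_le sqr_ge0 andbT (le_trans _ c0)// (bigD1 i)//= lerDl.
  by apply: sumr_ge0 => j _; exact: sqr_ge0.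
have [A00|An0] := eqVneq A 0.
  by rewrite big1 ?mulr_ge0// => i _; rewrite (zero _ A00) mul0r.
have [B00|Bn0] := eqVneq B 0.
  by rewrite big1 ?mulr_ge0// => i _; rewrite (zero _ B00) mulr0.
have AB : 0 < A * B by rewrite mulr_gt0// lt_def ?An0 ?Bn0.
have : 0 <= \sum_i (B * a i - A * b i) ^+ 2.
  by apply: sumr_ge0 => i _; exact: sqr_ge0.
have -> : \sum_i (B * a i - A * b i) ^+ 2 =
    2 * (A * B) * (A * B - \sum_i a i * b i).
  rewrite (eq_bigr (fun i => B ^+ 2 * a i ^+ 2 - 2 * (A * B) * (a i * b i)
    + A ^+ 2 * b i ^+ 2)); last first.
    move=> i _; rewrite sqrrB !exprMn; congr (_ - _ + _).
    by rewrite -mulr_natl -!mulrA (mulrCA (a i)) (mulrCA B).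
  rewrite big_split /= sumrB -!mulr_sumr -A2 -B2.
  rewrite mulrBr (mulrC (B ^+ 2)) -exprMn addrAC; congr (_ - _).
  by rewrite -[RHS]mulrA -expr2 mulr_natl mulr2n.
by rewrite pmulr_rge0 ?subr_ge0 ?(mulr_gt0 _ AB)//.
Qed.

Let ler_l2normD x y : l2norm (x + y) <= l2norm x + l2norm y.
Proof.
have S0 z : 0 <= \sum_i rnorm (z i) ^+ 2.
  by apply: sumr_ge0 => i _; exact: sqr_ge0.
rewrite -(@ler_pXn2r _ 2)// ?nnegrE ?addr_ge0//.
rewrite sqrrD !sqr_sqrtr//.
apply: (@le_trans _ _ (\sum_i (rnorm (x i) + rnorm (y i)) ^+ 2)).
  apply: ler_sum => i _; rewrite ffunE ler_pXn2r ?nnegrE ?addr_ge0 ?rnorm_ge0//.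
  exact: ler_rnormD.
under eq_bigr do rewrite sqrrD.
rewrite !big_split /= lerD2r lerD2l -mulr2n lerMn2r /=.
by apply: cauchy_schwarz => i; exact: rnorm_ge0.
Qed.

Let l2norm_act T x : Isom T -> l2norm (act T x) = l2norm x.
Proof.
by case=> nT _; congr Num.sqrt; apply: eq_bigr => i _; rewrite ffunE nT.
Qed.

Let actB T x y : act T (x - y) = act T x - act T y.
Proof. by apply/ffunP => i; rewrite !ffunE linearB. Qed.

Lemma Isom_id : Isom (idfun : {linear E -> E}).
Proof. by split=> // y; exists y. Qed.

Lemma Isom_comp (S T : {linear E -> E}) :
  Isom S -> Isom T -> Isom (S \o T : {linear E -> E}).
Proof.
move=> [nS sS] [nT sT]; split => [x|z] /=; first by rewrite nS nT.
by have [y <-] := sS z; have [x <-] := sT y; exists x.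
Qed.

Lemma Isom_inv T : Isom T ->
  exists2 S : {linear E -> E}, Isom S & cancel S T /\ cancel T S.
Proof.
move=> [nT sT].
have injT : injective T.
  move=> u v Tuv; apply/eqP; rewrite -subr_eq0; apply/eqP/rnorm_eq0.
  by rewrite -nT linearB Tuv subrr rnorm0.
pose g (v : E) := projT1 (cid (sT v)).
have gK : cancel g T by move=> v; rewrite /g; case: cid.
have Kg : cancel T g by move=> u; apply: injT; rewrite gK.
have lg : linear g by move=> a u v; apply: injT; rewrite linearP !gK.
pose gL := GRing.isLinear.Build _ _ _ _ g lg.
pose S : {linear E -> E} := HB.pack g gL.
exists S; split => //= [y|u]; first by rewrite -nT gK.
by exists (T u); exact: Kg.
Qed.

Let orbit_dist_le T x y : Isom T -> orbit_dist x y <= l2norm (act T x - y).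
Proof.
move=> iT; apply: ge_inf; last by exists T.
by exists 0 => _ [? _ <-].
Qed.

Let orbit_dist_lb x y (c : R) :
  (forall T, Isom T -> c <= l2norm (act T x - y)) -> c <= orbit_dist x y.
Proof.
move=> h; apply: lb_le_inf; last by move=> _ [T iT <-]; exact: h.
by exists (l2norm (act (idfun : {linear E -> E}) x - y)); exists (idfun : {linear E -> E}) => //;
  exact: Isom_id.
Qed.

Lemma orbit_dist_ge0 x y : 0 <= orbit_dist x y.
Proof. exact: orbit_dist_lb. Qed.

Lemma orbit_distxx x : orbit_dist x x = 0.
Proof.
apply/eqP; rewrite eq_le orbit_dist_ge0 andbT.
rewrite (le_trans (orbit_dist_le _ _ Isom_id))//.
rewrite (_ : _ - _ = 0); last by apply/ffunP => i; rewrite !ffunE subrr.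
rewrite /l2norm big1 ?sqrtr0// => i _.
by rewrite ffunE rnorm0 expr0n.
Qed.

Let orbit_dist_le_sym x y : orbit_dist x y <= orbit_dist y x.
Proof.
apply: orbit_dist_lb => T iT; have [S iS [SK KS]] := Isom_inv iT.
rewrite (le_trans (orbit_dist_le _ _ iS))// -(l2norm_act _ iT) actB.
rewrite -l2normN opprB (_ : act T (act S x) = x)//.
by apply/ffunP => i; rewrite !ffunE SK.
Qed.

Lemma orbit_dist_sym x y : orbit_dist x y = orbit_dist y x.
Proof. by apply/eqP; rewrite eq_le !orbit_dist_le_sym. Qed.

Lemma orbit_dist_triangle y x z :
  orbit_dist x z <= orbit_dist x y + orbit_dist y z.
Proof.
rewrite -lerBlDr; apply: orbit_dist_lb => T iT.
rewrite lerBlDl -lerBlDr; apply: orbit_dist_lb => S iS.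
rewrite lerBlDr.
rewrite (le_trans (orbit_dist_le _ _ (Isom_comp iS iT)))//.
rewrite -[X in _ <= _ + X](l2norm_act _ iS) actB.
apply: le_trans (ler_l2normD _ _); rewrite le_eqVlt; apply/orP; left; apply/eqP.
congr l2norm; apply/ffunP => i; rewrite !ffunE /=.
by rewrite [RHS]addrC [RHS]addrA subrK.
Qed.

Definition orbit_eq (u v : sphere_pow) : bool :=
  orbit_dist (\val u) (\val v) == 0.

Let orbit_eq_refl : reflexive orbit_eq.
Proof. by move=> u; rewrite /orbit_eq orbit_distxx. Qed.

Let orbit_eq_sym : symmetric orbit_eq.
Proof. by move=> u v; rewrite /orbit_eq orbit_dist_sym. Qed.

Let orbit_eq_trans : transitive orbit_eq.
Proof.
move=> v u w /eqP uv /eqP vw; rewrite /orbit_eq eq_le orbit_dist_ge0 andbT.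
by rewrite (le_trans (orbit_dist_triangle (\val v) _ _))// uv vw addr0.
Qed.

Canonical orbit_equiv := EquivRel orbit_eq
  orbit_eq_refl orbit_eq_sym orbit_eq_trans.

Local Open Scope quotient_scope.

Definition orbit_space := {eq_quot orbit_equiv}.

HB.instance Definition _ := Choice.on orbit_space.
HB.instance Definition _ := EqQuotient.on orbit_space.

(* Does not depend on the representatives: see orbit_mdistE below. *)
Definition orbit_mdist (p q : orbit_space) : R :=
  orbit_dist (\val (repr p)) (\val (repr q)).

Let orbit_mdistxx p : orbit_mdist p p = 0.
Proof. exact: orbit_distxx. Qed.

Let orbit_mdist_positivity p q : orbit_mdist p q = 0 -> p = q.
Proof.
move=> /eqP pq0; rewrite -[p]reprK -[q]reprK.
by apply/eqmodP.
Qed.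

Let orbit_mdist_sym p q : orbit_mdist p q = orbit_mdist q p.
Proof. exact: orbit_dist_sym. Qed.

Let orbit_mdist_triangle q p r :
  orbit_mdist p r <= orbit_mdist p q + orbit_mdist q r.
Proof. exact: orbit_dist_triangle. Qed.

HB.instance Definition _ := @isMetric.Build R orbit_space orbit_mdist
  orbit_mdistxx orbit_mdist_positivity orbit_mdist_sym orbit_mdist_triangle.

Lemma orbit_mdistE (u v : sphere_pow) :
  mdist (\pi_orbit_space u) (\pi_orbit_space v)
  = orbit_dist (\val u) (\val v).
Proof.
have le0 (a b c d : sphere_pow) : orbit_eq a c -> orbit_eq b d ->
    orbit_dist (\val a) (\val b) <= orbit_dist (\val c) (\val d).
  move=> /eqP ac /eqP bd.
  rewrite (le_trans (orbit_dist_triangle (\val c) _ _))// ac add0r.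
  rewrite (le_trans (orbit_dist_triangle (\val d) _ _))//.
  by rewrite (orbit_dist_sym (\val d)) bd addr0.
have piE w : orbit_eq (repr (\pi_orbit_space w)) w.
  by apply/eqmodP; rewrite reprK.
rewrite /mdist /= /orbit_mdist; apply/eqP; rewrite eq_le.
by rewrite !le0//= orbit_eq_sym.
Qed.

End orbit_space.

Definition omega_categorical (R : realType) (F : scalar_kind)
  (E : normedModType (scalar_field R F)) : Prop :=
  forall n : nat, compact [set: orbit_space E n].

(* Main.v *)
(* If E is approximately ultrahomogeneous and omega-categorical, take
   delta_m-isometries phi_m, psi_m with delta_m -> 0 on k-dimensional subspaces,
   each with a unit basis b_m whose coordinate functionals have norm at most 2.
   By compactness the normalized images of b_m have, up to isometries of E, a
   cluster point (d, e); in the limit d and e span isometric spaces, so some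
   isometry almost maps d to e, hence almost maps phi_m b_m to psi_m b_m.

   If E is Fraisse, let U be an ultrafilter on Q_n and choose a maximal
   subtuple whose limit norm along U is nondegenerate.  U-almost all such
   subtuples are (1 + delta)-equivalent, hence close in the orbit metric, and
   the other entries are in the limit fixed linear combinations of these; so U
   is Cauchy.  Since E is complete, Q_n is complete and U converges. *)
Require Import Defs.
From mathcomp Require Import all_boot all_order all_algebra perm.
From mathcomp Require Import all_classical all_reals all_analysis.
From mathcomp.real_closed Require Import complex.
From mathcomp Require Import ring lra.

Set Implicit Arguments.
Unset Strict Implicit.
Unset Printing Implicit Defensive.

Import Order.TTheory GRing.Theory Num.Theory.
Import numFieldNormedType.Exports.

Local Open Scope classical_set_scope.
Local Open Scope ring_scope.

Section scalars.
Context (R : realType) (F : scalar_kind).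
Local Notation K := (scalar_field R F).
Implicit Types (a b : K) (V : normedModType K).

Definition of_real : R -> K :=
  match F return R -> scalar_field R F with
  | RealScalars => id
  | ComplexScalars => real_complex R
  end.

Definition rabs a : R := real_part `|a|.

Lemma norm_of_real V (x : V) : `|x| = of_real (rnorm x).
Proof.
rewrite /rnorm /of_real; case: F V x => // W x.
by rewrite RRe_real// ger0_real.
Qed.

Lemma abs_of_real a : `|a| = of_real (rabs a).
Proof. by rewrite /rabs /of_real; case: F a. Qed.

Lemma of_realK : cancel of_real (@real_part R F).
Proof. by rewrite /of_real; case: F. Qed.

Lemma real_part_le a b : a <= b -> real_part a <= real_part b.
Proof. by case: F a b => //= a b; rewrite lecE => /andP[]. Qed.

Lemma of_realM (r s : R) : of_real (r * s) = of_real r * of_real s.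
Proof. by rewrite /of_real; case: F => //=; rewrite rmorphM. Qed.

Lemma of_realD (r s : R) : of_real (r + s) = of_real r + of_real s.
Proof. by rewrite /of_real; case: F => //=; rewrite rmorphD. Qed.

Lemma of_realB (r s : R) : of_real (r - s) = of_real r - of_real s.
Proof. by rewrite /of_real; case: F => //=; rewrite rmorphB. Qed.

Lemma of_real1 : of_real 1 = 1.
Proof. by rewrite /of_real; case: F => //=; rewrite rmorph1. Qed.

Lemma of_real0 : of_real 0 = 0.
Proof. by rewrite /of_real; case: F => //=; rewrite rmorph0. Qed.

Lemma of_real_gt0 (r : R) : 0 < r -> 0 < of_real r.
Proof. by rewrite /of_real; case: F => //=; rewrite ltcR. Qed.

Lemma rabs_of_real (r : R) : rabs (of_real r) = `|r|.
Proof.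
rewrite /rabs /of_real; case: F => //=.
by rewrite expr0n /= addr0 sqrtr_sqr.
Qed.

Lemma rnormZ V a (x : V) : rnorm (a *: x) = rabs a * rnorm x.
Proof. by rewrite {1}/rnorm normrZ abs_of_real norm_of_real -of_realM of_realK. Qed.

Lemma rabsM a b : rabs (a * b) = rabs a * rabs b.
Proof. by rewrite {1}/rabs normrM !abs_of_real -of_realM of_realK. Qed.

Lemma rabs_ge0 a : 0 <= rabs a.
Proof. by rewrite -(of_realK 0) of_real0; exact: real_part_le. Qed.

Lemma rabsD a b : rabs (a + b) <= rabs a + rabs b.
Proof.
rewrite -[leRHS]of_realK of_realD -!abs_of_real.
exact/real_part_le/ler_normD.
Qed.

Lemma rabsN a : rabs (- a) = rabs a.
Proof. by rewrite /rabs normrN. Qed.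

Lemma rabsBC a b : rabs (a - b) = rabs (b - a).
Proof. by rewrite -opprB rabsN. Qed.

Lemma rabs0 : rabs 0 = 0.
Proof. by rewrite -of_real0 rabs_of_real normr0. Qed.

Lemma rabs1 : rabs 1 = 1.
Proof. by rewrite -of_real1 rabs_of_real normr1. Qed.

Lemma rabs_eq0 a : rabs a = 0 -> a = 0.
Proof. by move=> a0; apply/normr0_eq0; rewrite abs_of_real a0 of_real0. Qed.

Lemma rabs_gt0 a : a != 0 -> 0 < rabs a.
Proof.
by move=> a0; rewrite lt_def rabs_ge0 andbT; apply: contra_neq a0 => /rabs_eq0.
Qed.

Lemma rabs_sum (I : Type) (r : seq I) (P : pred I) (f : I -> K) :
  rabs (\sum_(i <- r | P i) f i) <= \sum_(i <- r | P i) rabs (f i).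
Proof.
elim/big_ind2: _ => [|x1 x2 y1 y2 h1 h2|//]; first by rewrite rabs0.
by rewrite (le_trans (rabsD _ _))// lerD.
Qed.

Lemma rabs_prod (I : Type) (r : seq I) (P : pred I) (f : I -> K) :
  rabs (\prod_(i <- r | P i) f i) = \prod_(i <- r | P i) rabs (f i).
Proof. exact: (big_morph _ rabsM rabs1). Qed.

Lemma rnorm_sum V (I : Type) (r : seq I) (P : pred I) (f : I -> V) :
  rnorm (\sum_(i <- r | P i) f i) <= \sum_(i <- r | P i) rnorm (f i).
Proof.
elim/big_ind2: _ => [|x1 x2 y1 y2 h1 h2|//]; first by rewrite rnorm0.
by rewrite (le_trans (ler_rnormD _ _))// lerD.
Qed.

Lemma rnormBC V (x y : V) : rnorm (x - y) = rnorm (y - x).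
Proof. by rewrite -opprB rnormN. Qed.

Lemma ler_rnormB V (x y : V) : rnorm x - rnorm y <= rnorm (x - y).
Proof. by rewrite lerBlDr (le_trans _ (ler_rnormD _ _))// subrK. Qed.

Lemma ler_rnorm_triangle V (y x z : V) :
  rnorm (x - z) <= rnorm (x - y) + rnorm (y - z).
Proof. by rewrite (le_trans _ (ler_rnormD _ _))// addrA subrK. Qed.

Lemma ltr_norm_rnorm V (x : V) (e : K) : 0 < e ->
  (`|x| < e) = (rnorm x < real_part e) /\ 0 < real_part e.
Proof.
rewrite /rnorm => e0; have : 0 <= `|x| by [].
case: F V x e e0 => //= W x e; case: (`|x|) => c d /=.
by rewrite ltcE lecE /= => /andP[/eqP ei0 e0] /andP[/eqP -> _]; rewrite ltcE /= ei0 eqxx.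
Qed.

End scalars.

Section ultralimits.
Context (R : realType) (T : Type) (U : set_system T) {UU : UltraFilter U}.

Lemma real_ultralimit (f : T -> R) (B : R) : U [set t | `|f t| <= B] ->
  exists l, forall eta : R, 0 < eta -> U [set t | `|f t - l| < eta].
Proof.
move=> fB; have UP := @ultra_proper _ _ UU.
have [|l [_ cl]] := @segment_compact R (- B) B (f @ U) _ _.
  by rewrite /fmap /=; apply: filterS fB => t /=; rewrite in_itv /= -ler_norml.
exists l => eta eta0.
have [//|nU] := in_ultra_setVsetC [set t | `|f t - l| < eta] UU.
have [||y []] := cl (~` ball l eta) (ball l eta); last by [].
  by rewrite /fmap /=; apply: filterS nU => t /=; rewrite /ball /= distrC.
exact: nbhsx_ballx.
Qed.

Let Re_rabs (z : scalar_field R ComplexScalars) : `|complex.Re z| <= rabs z.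
Proof.
by rewrite /rabs normc_def /= -sqrtr_sqr ler_wsqrtr// lerDl sqr_ge0.
Qed.

Let Im_rabs (z : scalar_field R ComplexScalars) : `|complex.Im z| <= rabs z.
Proof.
by rewrite /rabs normc_def /= -sqrtr_sqr ler_wsqrtr// lerDr sqr_ge0.
Qed.

Let rabs_ReIm (z : scalar_field R ComplexScalars) :
  rabs z <= `|complex.Re z| + `|complex.Im z|.
Proof.
rewrite {1}[z]complexE (le_trans (rabsD _ _))// rabsM.
rewrite -!(@rabs_of_real R ComplexScalars) /= lerD2l.
by rewrite expr0n expr1n add0r sqrtr1 mul1r.
Qed.

Lemma bounded_ultralimit (F : scalar_kind) (f : T -> scalar_field R F) (B : R) :
  U [set t | rabs (f t) <= B] ->
  exists l, forall eta : R, 0 < eta -> U [set t | rabs (f t - l) < eta].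
Proof.
have UP := @ultra_proper _ _ UU.
case: F f => f fB; first exact: real_ultralimit fB.
have [|r rl] := @real_ultralimit (fun t => complex.Re (f t)) B.
  by apply: filterS fB => t /= /(le_trans _); apply; exact: Re_rabs.
have [|i il] := @real_ultralimit (fun t => complex.Im (f t)) B.
  by apply: filterS fB => t /= /(le_trans _); apply; exact: Im_rabs.
exists (r +i* i)%C => eta eta0.
have e2 : 0 < eta / 2 by rewrite divr_gt0.
apply: filterS2 (rl _ e2) (il _ e2) => t /= h1 h2.
rewrite (le_lt_trans (rabs_ReIm _))// (splitr eta).
by case: (f t) h1 h2 => x y /= ? ?; exact: ltrD.
Qed.

End ultralimits.

Section combinations.
Context (R : realType) (F : scalar_kind).
Local Notation K := (scalar_field R F).
Implicit Types (V W : normedModType K).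

Lemma ler_rnorm_comb V k (x : 'I_k -> V) (C : R) (a : 'I_k -> K) :
  (forall i, rnorm (x i) <= C) ->
  rnorm (\sum_i a i *: x i) <= C * \sum_i rabs (a i).
Proof.
move=> xC; rewrite (le_trans (rnorm_sum _ _ _))// mulr_sumr.
apply: ler_sum => i _; rewrite rnormZ mulrC.
by apply: ler_wpM2r; [exact: rabs_ge0|exact: xC].
Qed.

Lemma rnorm_comb_lipschitz V k (x : 'I_k -> V) (C : R) (a b : 'I_k -> K) :
  (forall i, rnorm (x i) <= C) ->
  rnorm (\sum_i a i *: x i) <=
    rnorm (\sum_i b i *: x i) + C * \sum_i rabs (a i - b i).
Proof.
move=> xC; rewrite -lerBlDl (le_trans (ler_rnormB _ _))// -sumrB.
under eq_bigr do rewrite -scalerBl.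
exact: ler_rnorm_comb.
Qed.

Lemma rnorm_comb_sub V k (x y : 'I_k -> V) (C : R) (a : 'I_k -> K) :
  (forall i, rnorm (x i - y i) <= C) ->
  rnorm (\sum_i a i *: x i) <= rnorm (\sum_i a i *: y i) + C * \sum_i rabs (a i).
Proof.
move=> xyC; rewrite -lerBlDl (le_trans (ler_rnormB _ _))// -sumrB.
under eq_bigr do rewrite -scalerBr.
exact: ler_rnorm_comb.
Qed.

Lemma rnorm_comb_dist V k (x y : 'I_k -> V) (C : R) (a : 'I_k -> K) :
  (forall i, rnorm (x i - y i) <= C) ->
  `|rnorm (\sum_i a i *: x i) - rnorm (\sum_i a i *: y i)| <= C * \sum_i rabs (a i).
Proof.
move=> xyC; rewrite ler_distlC lerBlDr !rnorm_comb_sub// => i.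
by rewrite rnormBC.
Qed.

Lemma rnorm_combZ V k (x : 'I_k -> V) (t : K) (a : 'I_k -> K) :
  rnorm (\sum_i (t * a i) *: x i) = rabs t * rnorm (\sum_i a i *: x i).
Proof.
by rewrite -rnormZ scaler_sumr; congr rnorm; apply: eq_bigr => i _; rewrite scalerA.
Qed.

Lemma lin_span0 V k (b : 'I_k -> V) : lin_span b 0.
Proof. by exists (fun=> 0); rewrite big1// => i _; rewrite scale0r. Qed.

Lemma lin_span_comb V k (b : 'I_k -> V) (c : 'I_k -> K) :
  lin_span b (\sum_i c i *: b i).
Proof. by exists c. Qed.

Lemma comb_delta V k (b : 'I_k -> V) i : \sum_j (j == i)%:R *: b j = b i :> V.
Proof.
rewrite (bigD1 i)//= eqxx scale1r big1 ?addr0// => j /negPf ->.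
by rewrite scale0r.
Qed.

Lemma lin_span_mem V k (b : 'I_k -> V) i : lin_span b (b i).
Proof. by exists (fun j => (j == i)%:R); rewrite comb_delta. Qed.

Lemma linear_on_comb V W k (b : 'I_k -> V) (f : V -> W) (c : 'I_k -> K) :
  linear_on (lin_span b) f ->
  f (\sum_i c i *: b i) = \sum_i c i *: f (b i).
Proof.
move=> lf.
have f0 : f 0 = 0.
  have := lf 1 0 0 (lin_span0 b) (lin_span0 b).
  by rewrite !scale1r addr0 => /eqP; rewrite -subr_eq0 opprD addrA subrr sub0r oppr_eq0 => /eqP.
have spanP (r : seq 'I_k) : lin_span b (\sum_(i <- r) c i *: b i) /\
    f (\sum_(i <- r) c i *: b i) = \sum_(i <- r) c i *: f (b i).
  elim: r => [|i r [[d dE] IH]]; first by rewrite !big_nil; split=> //; exact: lin_span0.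
  rewrite !big_cons; split; last first.
    by rewrite lf ?IH//; [exact: lin_span_mem|exists d].
  exists (fun j => c i * (j == i)%:R + d j).
  rewrite dE; symmetry; under eq_bigr do rewrite scalerDl -scalerA.
  by rewrite big_split /= -scaler_sumr comb_delta.
by have [] := spanP (index_enum 'I_k).
Qed.

Lemma comb_linear_on V W k (d : 'I_k -> V) (e : 'I_k -> W) (f : V -> W) :
  (forall c : 'I_k -> K, f (\sum_i c i *: d i) = \sum_i c i *: e i) ->
  linear_on (lin_span d) f.
Proof.
move=> fE a _ _ [c ->] [c' ->].
have -> : a *: (\sum_i c i *: d i) + \sum_i c' i *: d i =
    \sum_i (a * c i + c' i) *: d i.
  rewrite scaler_sumr -big_split; apply: eq_bigr => i _.
  by rewrite scalerDl scalerA.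
rewrite !fE scaler_sumr -big_split; apply: eq_bigr => i _.
by rewrite scalerDl scalerA.
Qed.

Lemma lin_indep_extend V W k (d : 'I_k -> V) (e : 'I_k -> W) : lin_indep d ->
  exists f : V -> W,
    forall c : 'I_k -> K, f (\sum_i c i *: d i) = \sum_i c i *: e i.
Proof.
move=> dI.
pose f (x : V) := if pselect (lin_span d x) is left h
  then \sum_i projT1 (cid h) i *: e i else 0 : W.
exists f => c; rewrite /f; case: pselect => [h|[]]; last exact: lin_span_comb.
case: (cid h) => c' /= cc'; apply: eq_bigr => i _; congr (_ *: _).
apply/eqP; rewrite eq_sym -subr_eq0; apply/eqP; apply: (dI (fun i => c i - c' i)).
under eq_bigr do rewrite scalerBl.
by rewrite sumrB cc' subrr.
Qed.

Lemma opnorm_le V W (X : set V) (f : V -> W) (C : R) : X 0 ->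
  (forall x, X x -> rnorm x <= 1 -> rnorm (f x) <= C) -> opnorm X f <= C.
Proof.
move=> X0 fC; apply: ge_sup; last by move=> _ [x [Xx x1] <-]; exact: fC.
by exists (rnorm (f 0)); exists 0 => //; split => //=; rewrite rnorm0.
Qed.

Lemma le_opnorm V W (X : set V) (f : V -> W) (C : R) (x : V) :
  (forall x, X x -> rnorm x <= 1 -> rnorm (f x) <= C) ->
  X x -> rnorm x <= 1 -> rnorm (f x) <= opnorm X f.
Proof.
move=> fC Xx x1; apply: ub_le_sup; last by exists x.
by exists C => _ [y [Xy y1] <-]; exact: fC.
Qed.

End combinations.

Section norm_equivalence.
Context (R : realType) (F : scalar_kind).
Local Notation K := (scalar_field R F).

Lemma bounded_ultralimit_coef (T : Type) (U : set_system T) k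
    (f : T -> 'I_k -> K) (B : R) : UltraFilter U ->
  U [set t | forall i, rabs (f t i) <= B] ->
  exists l : 'I_k -> K, forall eta : R, 0 < eta ->
    U [set t | forall i, rabs (f t i - l i) < eta].
Proof.
move=> UU fB; have UP := @ultra_proper _ _ UU.
have lim i : exists l : K, forall eta : R, 0 < eta -> U [set t | rabs (f t i - l) < eta].
  by apply: (bounded_ultralimit (B := B)); apply: filterS fB => t /= /(_ i).
have [l lP] := choice lim; exists l => eta eta0.
by apply: filter_forall => i; exact: lP.
Qed.

Lemma rabs_sum1 k (a : 'I_k -> K) i : rabs (a i) <= \sum_j rabs (a j).
Proof.
rewrite (bigD1 i)//= lerDl; apply: sumr_ge0 => j _; exact: rabs_ge0.
Qed.

Lemma rabs_sum_ge0 k (a : 'I_k -> K) : 0 <= \sum_j rabs (a j).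
Proof. by apply: sumr_ge0 => j _; exact: rabs_ge0. Qed.

Lemma norm_equivalence k (p : ('I_k -> K) -> R) (C : R) :
  (forall a, 0 <= p a) ->
  (forall a b, p a <= p b + C * \sum_i rabs (a i - b i)) ->
  (forall t a, p (fun i => t * a i) = rabs t * p a) ->
  (forall a, p a = 0 -> forall i, a i = 0) ->
  exists2 c : R, 0 < c & forall a : 'I_k -> K, c * \sum_i rabs (a i) <= p a.
Proof.
move=> p0 pL pZ pI; apply: contrapT => noc.
have bad (m : nat) : exists a : 'I_k -> K, \sum_i rabs (a i) = 1 /\ p a < m.+1%:R^-1.
  apply: contrapT => noa; apply: noc; exists m.+1%:R^-1; first by rewrite invr_gt0.
  move=> a; rewrite leNgt; apply/negP => pa; apply: noa.
  set s := \sum_i _ in pa.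
  have s0 : 0 < s.
    by rewrite -(@pmulr_rgt0 _ m.+1%:R^-1) ?invr_gt0// (le_lt_trans (p0 a)).
  have rs : rabs (of_real F s^-1) = s^-1 by rewrite rabs_of_real gtr0_norm ?invr_gt0.
  exists (fun i => of_real F s^-1 * a i); split.
    under eq_bigr do rewrite rabsM rs.
    by rewrite -mulr_sumr mulVf ?gt_eqF.
  by rewrite pZ rs mulrC ltr_pdivrMr.
have [f fP] := choice bad.
have [U [UU ooU]] := @ultraFilterLemma _ (\oo)%classic _.
have UP := @ultra_proper _ _ UU.
have [|l lP] := @bounded_ultralimit_coef _ U k f 1 UU.
  apply: filterE => m /= i; have [<- _] := fP m; exact: rabs_sum1.
have close (eta : R) : 0 < eta -> exists m,
    (forall i, rabs (f m i - l i) < eta) /\ m.+1%:R^-1 < eta.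
  move=> e0; apply: (@filter_ex _ U); apply: filterI; first exact: lP.
  exact/ooU/(near_infty_natSinv_lt (PosNum e0)).
have sumc m (eta : R) : (forall i, rabs (f m i - l i) < eta) ->
    \sum_i rabs (f m i - l i) <= k%:R * eta.
  move=> h; rewrite mulr_natl -[k in _ *+ k]card_ord -sumr_const.
  by apply: ler_sum => i _; exact/ltW.
have pl0 : p l = 0.
  apply/eqP; rewrite eq_le p0 andbT; apply/ler_addgt0Pl => e e0; rewrite addr0.
  have D0 : 0 < 1 + `|C| * k%:R by rewrite ltr_pwDl// mulr_ge0.
  have [m [h1 h2]] := close _ (divr_gt0 e0 D0).
  rewrite (le_trans (pL _ (f m)))//.
  under eq_bigr do rewrite rabsBC.
  rewrite -[leRHS](divfK (lt0r_neq0 D0)) mulrDr mulr1 lerD//.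
    by rewrite ltW// (lt_trans (proj2 (fP m))).
  rewrite (le_trans (ler_wpM2r (rabs_sum_ge0 _) (ler_norm C)))//.
  by rewrite [leRHS]mulrCA ler_wpM2l// mulrC sumc.
have l0 := pI _ pl0.
have k0 : 0 < k.+1%:R^-1 :> R by rewrite invr_gt0.
have [m [h1 _]] := close _ k0.
have := sumc _ _ h1; under eq_bigr do rewrite l0 subr0.
by rewrite (proj1 (fP m)) ler_pdivlMr// mul1r ler_nat ltnn.
Qed.

Lemma lin_indep_lower (V : normedModType K) k (b : 'I_k -> V) : lin_indep b ->
  exists2 c : R, 0 < c &
    forall a : 'I_k -> K, c * \sum_i rabs (a i) <= rnorm (\sum_i a i *: b i).
Proof.
move=> bI; apply: (@norm_equivalence k _ (\sum_i rnorm (b i))).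
- by move=> a; exact: rnorm_ge0.
- move=> a a'; apply: rnorm_comb_lipschitz => i.
  rewrite (bigD1 i)//= lerDl; apply: sumr_ge0 => j _; exact: rnorm_ge0.
- by move=> t a; rewrite rnorm_combZ.
- by move=> a /rnorm_eq0/bI.
Qed.

End norm_equivalence.

Section bases.
Context (R : realType) (F : scalar_kind).
Local Notation K := (scalar_field R F).
Implicit Types (V : normedModType K).

Lemma comb_mulmx V k (v : 'I_k -> V) (a : 'rV[K]_k) (M : 'M[K]_k) :
  \sum_i a 0 i *: (\sum_j M i j *: v j) = \sum_j (a *m M) 0 j *: v j.
Proof.
under eq_bigr do rewrite scaler_sumr.
rewrite exchange_big /=; apply: eq_bigr => j _.
by rewrite mxE scaler_suml; apply: eq_bigr => i _; rewrite scalerA.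
Qed.

(* A basis of vectors of norm one maximizing the determinant up to a factor 2:
   by Cramer's rule the coordinates of a unit vector are quotients of two such
   determinants. *)
Lemma Age_bounded_basis V k (X : set V) : Age_ V k X ->
  exists b : 'I_k -> V, [/\ X = lin_span b, forall i, rnorm (b i) = 1 &
    forall (a : 'I_k -> K) i, rabs (a i) <= 2 * rnorm (\sum_i a i *: b i)].
Proof.
move=> [v vI ->]; have [c c0 vc] := lin_indep_lower vI.
pose N (m : 'rV[K]_k) : R := rnorm (\sum_j m 0 j *: v j).
have NZ t (m : 'rV[K]_k) : N (t *: m) = rabs t * N m.
  by rewrite /N -rnorm_combZ; congr rnorm; apply: eq_bigr => j _; rewrite mxE.
have N0 m : N m = 0 -> m = 0.
  by move=> /rnorm_eq0/vI m0; apply/rowP => j; rewrite m0 mxE.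
have rI (r : R) : 0 < r -> rabs (of_real F r^-1) = r^-1.
  by move=> r0; rewrite rabs_of_real gtr0_norm ?invr_gt0.
pose S := [set rabs (\det M) | M in [set M : 'M[K]_k | forall i, N (row i M) = 1]].
have Sub : has_ubound S.
  exists (\sum_(s : {perm 'I_k}) \prod_(i < k) c^-1) => _ [M MN <-].
  rewrite /determinant (le_trans (rabs_sum _ _ _))//; apply: ler_sum => s _.
  have -> : rabs ((-1) ^+ s * \prod_i M i (s i)) = \prod_i rabs (M i (s i)).
    by rewrite rabsM rabs_prod; case: odd_perm; rewrite ?expr0 ?expr1 ?rabsN rabs1 mul1r.
  apply: ler_prod => i _; rewrite rabs_ge0 /=.
  have := vc (fun j => row i M 0 j); rewrite -/(N _) MN mulrC -ler_pdivlMr// div1r.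
  apply: le_trans; have := @rabs_sum1 _ _ _ (fun j => row i M 0 j) (s i).
  by rewrite mxE.
have v0 i : 0 < rnorm (v i).
  rewrite lt_def rnorm_ge0 andbT; apply/eqP => /rnorm_eq0 vi0.
  have := vI (fun j => (j == i)%:R); rewrite comb_delta vi0 => /(_ erefl i)/eqP.
  by rewrite eqxx oner_eq0.
pose D : 'M[K]_k := diag_mx (\row_i of_real F (rnorm (v i))^-1).
have SD : S (rabs (\det D)).
  exists D => //= i; rewrite /N.
  under eq_bigr => j _.
    rewrite !mxE -mulr_natr eq_sym -scalerA.
    over.
  by rewrite -scaler_sumr comb_delta rnormZ rI// mulVf ?gt_eqF.
have D0 : 0 < rabs (\det D).
  rewrite det_diag rabs_prod; apply: prodr_gt0 => i _.
  by rewrite mxE rI// invr_gt0.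
have S0 : 0 < sup S by rewrite (lt_le_trans D0)// ub_le_sup.
have [|_ [M MN <-] Mdet] := @sup_adherent _ S (sup S / 2) (divr_gt0 S0 (ltr0Sn _ 1)).
  by split=> //; exists (rabs (\det D)).
have {}Mdet : sup S < 2 * rabs (\det M) by lra.
have M0 : 0 < rabs (\det M) by lra.
have Munit : M \in unitmx.
  by rewrite unitmxE unitfE; apply: contraTneq M0 => ->; rewrite rabs0 ltxx.
pose b i : V := \sum_j M i j *: v j.
have coefE (a : 'I_k -> K) : \sum_i a i *: b i = \sum_j ((\row_i a i) *m M) 0 j *: v j.
  by rewrite -comb_mulmx; apply: eq_bigr => i _; rewrite mxE.
have cramer (m : 'rV[K]_k) i : rabs ((m *m \adj M) 0 i) <= sup S * N m.
  have [Nm0|Nm0] := eqVneq (N m) 0.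
    by rewrite Nm0 (N0 _ Nm0) mul0mx mxE rabs0 mulr0.
  have {}Nm0 : 0 < N m by rewrite lt_def Nm0 rnorm_ge0.
  pose m' := of_real F (N m)^-1 *: m.
  have Nm' : N m' = 1 by rewrite NZ rI// mulVf ?gt_eqF.
  pose M' := \matrix_(p, j) if p == i then m' 0 j else M p j.
  have -> : (m *m \adj M) 0 i = of_real F (N m) * \det M'.
    have -> : m = of_real F (N m) *: m'.
      by rewrite scalerA -of_realM mulfV ?gt_eqF// of_real1 scale1r.
    rewrite -scalemxAl mxE NZ Nm' mulr1 rabs_of_real gtr0_norm//; congr (_ * _).
    rewrite (expand_det_row _ i) mxE; apply: eq_bigr => j _.
    rewrite !mxE eqxx; congr (_ * (_ * \det _)).
    by apply/matrixP => p q; rewrite !mxE eq_sym (negPf (neq_lift _ _)).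
  rewrite rabsM rabs_of_real gtr0_norm// mulrC ler_wpM2r ?rnorm_ge0//.
  apply: ub_le_sup => //; exists M' => //= p; rewrite /N.
  have [->|pi] := eqVneq p i.
    by rewrite -Nm' /N; congr rnorm; apply: eq_bigr => j _; rewrite !mxE eqxx.
  by rewrite -(MN p) /N; congr rnorm; apply: eq_bigr => j _; rewrite !mxE (negPf pi).
exists b; split.
- apply/seteqP; split => [_ [d ->]|_ [a ->]]; last by rewrite coefE; exact: lin_span_comb.
  have := lin_span_comb b (fun j => ((\row_i d i) *m invmx M) 0 j).
  rewrite coefE; congr lin_span; apply: eq_bigr => j _; congr (_ *: _).
  rewrite (_ : \row__ _ = (\row_i d i) *m invmx M); last by apply/rowP => i; rewrite mxE.
  by rewrite mulmxKV// mxE.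
- by move=> i; rewrite -(MN i) /N; congr rnorm; apply: eq_bigr => j _; rewrite mxE.
- move=> a i; have := cramer ((\row_i a i) *m M) i.
  rewrite -mulmxA mul_mx_adj mul_mx_scalar mxE mxE rabsM -/(N _) coefE -/(N _).
  set r := N _ => h; rewrite -(ler_pM2l M0) (le_trans h)// mulrA (mulrC _ 2).
  by rewrite ler_wpM2r ?rnorm_ge0// ltW.
Qed.

End bases.

Section orbits.
Context (R : realType) (F : scalar_kind) (E : normedModType (scalar_field R F)).
Local Notation K := (scalar_field R F).
Local Notation Isom := (@Isom R F E).

Lemma Isom_rnormB (T : {linear E -> E}) (x y : E) : Isom T ->
  rnorm (T x - T y) = rnorm (x - y).
Proof. by move=> [nT _]; rewrite -linearB nT. Qed.

Lemma Isom_comb (T : {linear E -> E}) k (x : 'I_k -> E) (a : 'I_k -> K) : Isom T ->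
  rnorm (\sum_i a i *: T (x i)) = rnorm (\sum_i a i *: x i).
Proof.
move=> [nT _]; rewrite -[RHS]nT linear_sum; congr rnorm.
by apply: eq_bigr => i _; rewrite linearZ.
Qed.

Lemma rnorm_le_l2norm n (x : {ffun 'I_n -> E}) i : rnorm (x i) <= l2norm x.
Proof.
rewrite -[leLHS]ger0_norm ?rnorm_ge0// -sqrtr_sqr ler_wsqrtr// (bigD1 i)//= lerDl.
by apply: sumr_ge0 => j _; exact: sqr_ge0.
Qed.

Lemma l2norm_le n (x : {ffun 'I_n -> E}) (eta : R) : 0 <= eta ->
  (forall i, rnorm (x i) <= eta) -> l2norm x <= n%:R * eta.
Proof.
move=> e0 xe; rewrite -[leRHS]ger0_norm ?mulr_ge0// -sqrtr_sqr ler_wsqrtr//.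
rewrite (@le_trans _ _ (n%:R * eta ^+ 2))//.
  rewrite mulr_natl -[n in _ *+ n]card_ord -sumr_const; apply: ler_sum => i _.
  by rewrite lerXn2r ?nnegrE ?rnorm_ge0.
rewrite exprMn ler_wpM2r ?sqr_ge0//.
case: n {x xe} => [|n]; first by rewrite expr0n.
by rewrite expr2 ler_peMr// ler1n.
Qed.

Lemma orbit_dist_lt n (x y : {ffun 'I_n -> E}) (eta : R) : orbit_dist x y < eta ->
  exists2 T : {linear E -> E}, Isom T & l2norm (act T x - y) < eta.
Proof.
move=> xy.
have e0 : 0 < eta - orbit_dist x y by rewrite subr_gt0.
have [|_ [T iT <-] Te] := @inf_adherent _ [set l2norm (act T x - y) | T in Isom] _ e0.
  split; last by exists 0 => _ [T _ <-]; exact: sqrtr_ge0.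
  exists (l2norm (act (idfun : {linear E -> E}) x - y)).
  by exists (idfun : {linear E -> E}) => //; exact: Isom_id.
exists T => //; rewrite (lt_le_trans Te)//.
by rewrite -/(orbit_dist x y) addrC subrK.
Qed.

Lemma orbit_dist_le n (x y : {ffun 'I_n -> E}) (T : {linear E -> E}) : Isom T ->
  orbit_dist x y <= l2norm (act T x - y).
Proof.
move=> iT; apply: ge_inf; last by exists T.
by exists 0 => _ [S _ <-]; exact: sqrtr_ge0.
Qed.

Definition orbit_repr n (q : orbit_space E n) : {ffun 'I_n -> E} := \val (repr q).

Lemma orbit_repr_unit n (q : orbit_space E n) i : rnorm (orbit_repr q i) = 1.
Proof. by have := set_valP (repr q); exact. Qed.

Lemma mdist_repr n (q q' : orbit_space E n) :
  mdist q q' = orbit_dist (orbit_repr q) (orbit_repr q').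
Proof. by []. Qed.

Lemma orbit_space_surj n (x : {ffun 'I_n -> E}) : (forall i, rnorm (x i) = 1) ->
  exists q : orbit_space E n, orbit_dist (orbit_repr q) x = 0.
Proof.
move=> x1; have xS : x \in @sphere_pow R F E n by exact/mem_set.
pose u : @sphere_pow R F E n := exist _ x xS.
exists (\pi_(orbit_space E n)%qT u).
have : orbit_eq (repr (\pi_(orbit_space E n)%qT u)) u by apply/eqmodP; rewrite reprK.
by move=> /eqP.
Qed.

End orbits.

Section completeness.
Context (R : realType) (F : scalar_kind).
Local Notation K := (scalar_field R F).

Lemma exprV2_small (e : R) : 0 < e -> exists m, 2 * 2^-1 ^+ m < e.
Proof.
move=> e0; have := @upper_nthrootP R (2 / e) _ (leqnn _).
set m := Num.Def.archi_bound _ => me; exists m.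
by rewrite exprVn ltr_pdivrMr ?exprn_gt0// mulrC -ltr_pdivrMr.
Qed.

Lemma geometric_cauchy_cvg (E : completeNormedModType K) (y : nat -> E) :
  (forall m, rnorm (y m - y m.+1) <= 2^-1 ^+ m) ->
  exists l, forall m, rnorm (y m - l) <= 2 * 2^-1 ^+ m.
Proof.
move=> yC.
have tail m p : rnorm (y m - y (m + p)%N) <= 2 * 2^-1 ^+ m - 2 * 2^-1 ^+ (m + p).
  elim: p => [|p IH]; first by rewrite addn0 !subrr rnorm0.
  rewrite (le_trans (ler_rnorm_triangle (y (m + p)%N) _ _))// addnS.
  have := yC (m + p)%N; rewrite exprS.
  have -> : 2 * (2^-1 * 2^-1 ^+ (m + p)) = 2^-1 ^+ (m + p) :> R.
    by rewrite mulrA mulfV ?mul1r// pnatr_eq0.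
  by move=> H; rewrite (le_trans (lerD IH H))// -addrA lerD2l mulr_natl mulr2n opprD addrNK.
have pow0 m : 0 < 2^-1 ^+ m :> R by rewrite exprn_gt0.
have {}tail m p : rnorm (y m - y (m + p)%N) <= 2 * 2^-1 ^+ m.
  by rewrite (le_trans (tail _ _))// gerBl mulr_ge0// ltW.
have yc : cauchy (y @ \oo).
  apply: cauchy_exP => e e0.
  have [m me] := exprV2_small (proj2 (ltr_norm_rnorm (0 : E) e0)).
  exists (y m); exists m => // j /= /subnKC <-.
  by rewrite -ball_normE /= (proj1 (ltr_norm_rnorm _ e0)) (le_lt_trans (tail _ _)).
have /cvg_ex[l yl] : cvg (y @ \oo) by apply/cauchy_cvgP.
exists l => m; apply/ler_addgt0Pl => e e0.
have e0' : 0 < of_real F e by exact: of_real_gt0.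
have /cvgrPdist_lt /(_ _ e0') [p _ /(_ (m + p)%N (leq_addl _ _)) /=] := yl.
rewrite (proj1 (ltr_norm_rnorm _ e0')) of_realK rnormBC => /ltW le.
by rewrite [leRHS]addrC (le_trans (ler_rnorm_triangle (y (m + p)%N) _ _))// lerD.
Qed.

Lemma orbit_space_geometric_cvg (E : completeNormedModType K) n
    (q : nat -> orbit_space E n) :
  (forall m, mdist (q m) (q m.+1) < 2^-1 ^+ m) ->
  exists q', forall m, mdist (q m) q' <= n%:R * (2 * 2^-1 ^+ m).
Proof.
move=> qC; pose x m := orbit_repr (q m).
have step m : exists T : {linear E -> E}, Isom T /\
    l2norm (act T (x m) - x m.+1) < 2^-1 ^+ m.
  by have [T iT Tx] := orbit_dist_lt (qC m); exists T.
have [T TP] := choice step.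
have [T' T'P] : {T' : nat -> {linear E -> E} | forall m, Isom (T' m) /\ cancel (T' m) (T m)}.
  have /choice[T' T'P] m : exists S : {linear E -> E}, Isom S /\ cancel S (T m).
    by have [S iS [SK _]] := Isom_inv (proj1 (TP m)); exists S.
  by exists T'.
pose S := fix S m : {linear E -> E} :=
  if m is m'.+1 then (S m' \o T' m' : {linear E -> E}) else idfun.
have iS m : Isom (S m).
  elim: m => [|m IH]; first exact: Isom_id.
  exact: Isom_comp IH (proj1 (T'P m)).
have yC i m : rnorm (S m (x m i) - S m.+1 (x m.+1 i)) <= 2^-1 ^+ m.
  rewrite /= Isom_rnormB// -(Isom_rnormB _ _ (proj1 (TP m))) (proj2 (T'P m)).
  have := rnorm_le_l2norm (act (T m) (x m) - x m.+1) i.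
  by rewrite !ffunE => /le_trans; apply; exact/ltW/(proj2 (TP m)).
have [l lP] := choice (fun i => geometric_cauchy_cvg (yC i)).
pose lf := [ffun i => l i].
have l1 i : rnorm (lf i) = 1.
  apply/eqP; rewrite ffunE -subr_eq0 -normr_le0; apply/ler_addgt0Pl => e e0.
  have [m me] := exprV2_small e0; rewrite addr0 ltW// (le_lt_trans _ me)//.
  rewrite (le_trans _ (lP i m))//.
  have nS : rnorm (S m (x m i)) = 1 by rewrite (proj1 (iS m)) orbit_repr_unit.
  rewrite -[in X in `|X|]nS ler_distl; apply/andP; split.
    by rewrite lerBlDl -lerBlDr ler_rnormB.
  by rewrite -lerBlDl rnormBC ler_rnormB.
have [q' q'l] := orbit_space_surj l1; exists q' => m.
rewrite mdist_repr (le_trans (orbit_dist_triangle lf _ _))//.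
rewrite (orbit_dist_sym lf) q'l addr0 (le_trans (orbit_dist_le _ _ (iS m)))//.
by apply: l2norm_le => [|i]; rewrite ?mulr_ge0 ?exprn_ge0 ?invr_ge0// !ffunE.
Qed.

End completeness.

Section ultrahomogeneous.
Context (R : realType) (F : scalar_kind) (E : normedModType (scalar_field R F)).
Local Notation K := (scalar_field R F).

Lemma rnorm_sub_normalize (y : E) : 0 < rnorm y ->
  rnorm (of_real F (rnorm y)^-1 *: y) = 1 /\
  rnorm (y - of_real F (rnorm y)^-1 *: y) = `|rnorm y - 1|.
Proof.
move=> y0; split.
  by rewrite rnormZ rabs_of_real gtr0_norm ?invr_gt0// mulVf ?gt_eqF.
rewrite -[X in X - _]scale1r -scalerBl -of_real1 -of_realB rnormZ rabs_of_real.
by rewrite -{2}(gtr0_norm y0) -normrM mulrBl mul1r mulVf ?gt_eqF.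
Qed.

Lemma Emb_normalize (delta : R) k (b : 'I_k -> E) (f : E -> E) : 0 <= delta ->
  (forall i, rnorm (b i) = 1) -> Emb_ delta (lin_span b) f ->
  exists u : 'I_k -> E, [/\ forall i, rnorm (u i) = 1,
    forall i, rnorm (f (b i) - u i) <= delta &
    forall a : 'I_k -> K, `|rnorm (\sum_i a i *: u i) - rnorm (\sum_i a i *: b i)|
      <= 2 * delta * \sum_i rabs (a i)].
Proof.
move=> d0 b1 [lf fE].
have d1 : 0 < 1 + delta by rewrite ltr_pwDl.
have dV : 1 - delta <= (1 + delta)^-1.
  by rewrite -[leRHS]div1r ler_pdivlMr//; nra.
have dV0 : 0 < (1 + delta)^-1 by rewrite invr_gt0.
have f0 i : 0 < rnorm (f (b i)).
  have /andP[+ _] := fE _ (lin_span_mem b i).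
  by rewrite b1 mulr1; exact: lt_le_trans.
pose u i := of_real F (rnorm (f (b i)))^-1 *: f (b i).
have fu i : rnorm (f (b i) - u i) <= delta.
  rewrite (proj2 (rnorm_sub_normalize (f0 i))).
  have /andP[] := fE _ (lin_span_mem b i).
  by rewrite b1 !mulr1 ler_distl => h1 h2; lra.
exists u; split=> // [i|a]; first exact: (proj1 (rnorm_sub_normalize (f0 i))).
set s := \sum_i rabs (a i).
have h1 : rnorm (\sum_i a i *: u i) <= rnorm (\sum_i a i *: f (b i)) + delta * s.
  by apply: rnorm_comb_sub => i; rewrite rnormBC.
have h2 : rnorm (\sum_i a i *: f (b i)) <= rnorm (\sum_i a i *: u i) + delta * s.
  exact: rnorm_comb_sub.
have h3 : rnorm (\sum_i a i *: b i) <= 1 * s.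
  by apply: ler_rnorm_comb => i; rewrite b1.
have := fE _ (lin_span_comb b a).
rewrite (linear_on_comb _ lf).
have r0 := rnorm_ge0 (\sum_i a i *: b i).
rewrite ler_distl.
move: r0 h1 h2 h3.
set x := rnorm (\sum_i a i *: u i); set y := rnorm (\sum_i _ *: f _).
set z := rnorm _ => r0 h1 h2 h3 /andP[h4 h5].
have h6 : (1 - delta) * z <= (1 + delta)^-1 * z by rewrite ler_wpM2r.
have h7 : delta * z <= delta * s by rewrite ler_wpM2l// (le_trans h3)// mul1r.
apply/andP; split; nra.
Qed.

Lemma ler_forall_gt0 (x y C : R) : 0 <= C ->
  (forall eta : R, 0 < eta -> x <= y + C * eta) -> x <= y.
Proof.
move=> C0 h; apply/ler_addgt0Pl => e e0.
have C1 : 0 < C + 1 by rewrite ltr_wpDl.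
rewrite addrC (le_trans (h _ (divr_gt0 e0 C1)))// lerD2l mulrCA ler_piMr ?(ltW e0)//.
by rewrite ler_pdivrMr// mul1r lerDl.
Qed.

Lemma fraisse_of_ultrahomogeneous_categorical :
  approximately_ultrahomogeneous E -> omega_categorical E -> fraisse E.
Proof.
move=> AuH omega eps k eps0; apply: contrapT => nofr.
pose del (m : nat) : R := m.+1%:R^-1.
have del0 m : 0 < del m by rewrite invr_gt0.
pose l (i : 'I_k) : 'I_(k + k) := lshift k i.
pose r (i : 'I_k) : 'I_(k + k) := rshift k i.
have bad m : exists zb : {ffun 'I_(k + k) -> E} * ('I_k -> E),
  (forall i, rnorm (zb.1 i) = 1) /\
  [/\ forall (a : 'I_k -> K) i, rabs (a i) <= 2 * rnorm (\sum_i a i *: zb.2 i),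
   forall a : 'I_k -> K,
     `|rnorm (\sum_i a i *: zb.1 (l i)) - rnorm (\sum_i a i *: zb.2 i)|
       <= 2 * del m * \sum_i rabs (a i),
   forall a : 'I_k -> K,
     `|rnorm (\sum_i a i *: zb.1 (r i)) - rnorm (\sum_i a i *: zb.2 i)|
       <= 2 * del m * \sum_i rabs (a i) &
   forall (T : {linear E -> E}) (eta : R), Isom T -> 0 <= eta ->
     (forall i, rnorm (T (zb.1 (l i)) - zb.1 (r i)) <= eta) ->
     eps <= 2 * k%:R * (eta + 2 * del m)].
  have [X [phi [psi [XA phiE psiE noT]]]] : exists X phi psi,
      [/\ Age_ E k X, Emb_ (del m) X phi, Emb_ (del m) X psi &
       ~ exists2 T : {linear E -> E}, Isom T & opnorm X ((T \o phi) \- psi) < eps].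
    apply: contrapT => h; apply: nofr; exists (del m) => // X XA phi psi hphi hpsi.
    by apply: contrapT => noT; apply: h; exists X, phi, psi.
  have [b [XE b1 bP]] := Age_bounded_basis XA; rewrite {}XE {XA X} in phiE psiE noT *.
  have [u [u1 phiu uP]] := Emb_normalize (ltW (del0 m)) b1 phiE.
  have [w [w1 psiw wP]] := Emb_normalize (ltW (del0 m)) b1 psiE.
  pose z : {ffun 'I_(k + k) -> E} := [ffun j =>
    match fintype.split j with inl i => u i | inr i => w i end].
  have zl i : z (l i) = u i by rewrite ffunE (unsplitK (inl _ i)).
  have zr i : z (r i) = w i by rewrite ffunE (unsplitK (inr _ i)).
  exists (z, b); split => /=; first by move=> i; rewrite ffunE; case: fintype.split.
  split=> // [a|a|T eta iT eta0 Te].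
  - by under eq_bigr do rewrite zl; exact: uP.
  - by under eq_bigr do rewrite zr; exact: wP.
  rewrite leNgt; apply/negP => small; apply: noT; exists T => //.
  apply: le_lt_trans small; apply: opnorm_le; first exact: lin_span0.
  move=> _ [a ->] a1 /=.
  rewrite (linear_on_comb _ (proj1 phiE)) (linear_on_comb _ (proj1 psiE)) linear_sum -sumrB.
  under eq_bigr do rewrite linearZ -scalerBr.
  have Tb i : rnorm (T (phi (b i)) - psi (b i)) <= eta + 2 * del m.
    rewrite (le_trans (ler_rnorm_triangle (T (u i)) _ _))// Isom_rnormB//.
    have := ler_rnorm_triangle (w i) (T (u i)) (psi (b i)).
    have := phiu i; have := psiw i; have := Te i.
    by rewrite zl zr (rnormBC (w i)); lra.
  have bound0 : 0 <= eta + 2 * del m by rewrite addr_ge0// mulr_ge0// ltW.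
  rewrite (le_trans (ler_rnorm_comb _ Tb))// mulrC ler_wpM2r//.
  rewrite mulr_natr -[k in _ *+ k]card_ord -sumr_const; apply: ler_sum => i _.
  by rewrite (le_trans (bP a i))// ler_piMr.
have {bad} [zb zbP] := choice bad.
pose z m := (zb m).1; pose b m := (zb m).2.
have zP m := proj2 (zbP m).
have /choice[p pz] m := orbit_space_surj (proj1 (zbP m)).
have [q [_ qcl]] := omega (k + k)%N (p @ \oo) _ filterT.
pose d i := orbit_repr q (l i).
pose e i := orbit_repr q (r i).
have close (eta : R) : 0 < eta -> exists m, del m < eta /\
    exists2 T : {linear E -> E}, Isom T &
      forall i, rnorm (T (z m i) - orbit_repr q i) < eta.
  move=> e0.
  have [||_ [[m me <-]]] := qcl (p @` [set m | del m < eta]) (ball q eta).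
  - rewrite /fmap /=; have := near_infty_natSinv_lt (PosNum e0).
    by apply: filterS => m /= me; exists m.
  - exact: nbhsx_ballx.
  rewrite ballEmdist /= metric_sym mdist_repr => pq.
  have /orbit_dist_lt[T iT Te] : orbit_dist (z m) (orbit_repr q) < eta.
    rewrite (le_lt_trans _ pq)// (le_trans (orbit_dist_triangle (orbit_repr (p m)) _ _))//.
    by rewrite orbit_dist_sym pz add0r.
  exists m; split=> //; exists T => // i; apply: le_lt_trans Te.
  by have := rnorm_le_l2norm (act T (z m) - orbit_repr q) i; rewrite !ffunE.
have near_b (a : 'I_k -> K) (eta : R) : 0 < eta -> exists m,
   [/\ forall i, rabs (a i) <= 2 * rnorm (\sum_i a i *: b m i),
    `|rnorm (\sum_i a i *: d i) - rnorm (\sum_i a i *: b m i)|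
      <= 3 * eta * \sum_i rabs (a i) &
    `|rnorm (\sum_i a i *: e i) - rnorm (\sum_i a i *: b m i)|
      <= 3 * eta * \sum_i rabs (a i)].
  move=> eta0; have [m [me [T iT Te]]] := close _ eta0; exists m.
  have [bP zl zr _] := zP m; have s0 := rabs_sum_ge0 a.
  have ms : del m * \sum_i rabs (a i) <= eta * \sum_i rabs (a i).
    by rewrite ler_wpM2r// ltW.
  have Tz (g : 'I_k -> 'I_(k + k)) :
      `|rnorm (\sum_i a i *: orbit_repr q (g i)) - rnorm (\sum_i a i *: z m (g i))|
        <= eta * \sum_i rabs (a i).
    rewrite -(Isom_comb (fun i => z m (g i)) _ iT); apply: rnorm_comb_dist => i.
    by rewrite rnormBC ltW.
  by split=> //; [have := zl a; have := Tz l|have := zr a; have := Tz r];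
     rewrite !ler_distl => /andP[? ?] /andP[? ?]; apply/andP; split; lra.
have dE a : rnorm (\sum_i a i *: e i) = rnorm (\sum_i a i *: d i).
  apply/eqP; rewrite -subr_eq0 -normr_le0.
  apply: (@ler_forall_gt0 _ _ (6 * \sum_i rabs (a i))).
    by rewrite mulr_ge0// rabs_sum_ge0.
  move=> eta /(near_b a)[m [_ h1 h2]]; rewrite add0r.
  by move: h1 h2; rewrite !ler_distl => /andP[? ?] /andP[? ?]; apply/andP; split; lra.
have da (a : 'I_k -> K) i : rabs (a i) <= 2 * rnorm (\sum_i a i *: d i).
  apply: (@ler_forall_gt0 _ _ (6 * \sum_i rabs (a i))).
    by rewrite mulr_ge0// rabs_sum_ge0.
  move=> eta /(near_b a)[m [/(_ i) h h1 _]].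
  by move: h1; rewrite !ler_distl => /andP[? ?]; lra.
have dI : lin_indep d.
  move=> a a0 i; apply: rabs_eq0; apply/eqP; rewrite eq_le rabs_ge0 andbT.
  by have := da a i; rewrite a0 rnorm0 mulr0.
have [psi psiE] := lin_indep_extend e dI.
pose eta : R := eps / (10 * k%:R + 1).
have k1 : 0 < 10 * k%:R + 1 :> R by rewrite ltr_wpDl// mulr_ge0.
have eta0 : 0 < eta by rewrite divr_gt0.
have Xd : Age E (lin_span d) by exists k => //; exists d.
have id_emb : Emb (lin_span d) (id : E -> E) by split.
have psi_emb : Emb (lin_span d) psi.
  split; first exact: comb_linear_on psiE.
  by move=> _ [a ->]; rewrite psiE.
have [S iS Spsi] := AuH _ Xd _ eta0 _ _ id_emb psi_emb.
have Sd i : rnorm (S (d i) - e i) <= eta.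
  have -> : e i = psi (d i) by rewrite -[d i in RHS]comb_delta psiE comb_delta.
  apply: le_trans (ltW Spsi).
  apply: (@le_opnorm _ _ _ _ _ ((S \o id) \- psi) 2).
  - move=> x Xx x1 /=; rewrite (le_trans (ler_rnormD _ _))// rnormN.
    by rewrite (proj1 iS) (proj2 psi_emb)//; lra.
  - exact: lin_span_mem.
  - by rewrite orbit_repr_unit.
have [m [me [T iT Tclose]]] := close _ eta0.
have [T' iT' [TK KT]] := Isom_inv iT.
have [_ _ _ zT] := zP m.
have iTST : Isom (T' \o S \o T : {linear E -> E}).
  exact: Isom_comp (Isom_comp iT' iS) iT.
have : eps <= 2 * k%:R * (3 * eta + 2 * del m).
  apply: zT iTST _ _; first by rewrite mulr_ge0// ltW.
  move=> i /=; rewrite -(Isom_rnormB _ _ iT) TK -/(z m).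
  have := ler_rnorm_triangle (S (d i)) (S (T (z m (l i)))) (T (z m (r i))).
  have := ler_rnorm_triangle (e i) (S (d i)) (T (z m (r i))).
  have := Tclose (l i); have := Tclose (r i); have := Sd i.
  rewrite (Isom_rnormB _ _ iS) rnormBC (rnormBC (e i)) -/(d i) -/(e i); lra.
apply/negP; rewrite -ltNge.
have h : 3 * eta + 2 * del m <= 5 * eta by lra.
rewrite (@le_lt_trans _ _ (2 * k%:R * (5 * eta)))//.
  by rewrite ler_wpM2l// mulr_ge0.
have : eta * (10 * k%:R + 1) = eps by rewrite divfK ?gt_eqF.
lra.
Qed.

End ultrahomogeneous.

Section ultralimit_norms.
Context (R : realType) (F : scalar_kind).
Local Notation K := (scalar_field R F).

Definition lipschitz_seminorm k (p : ('I_k -> K) -> R) : Prop :=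
  [/\ forall a, 0 <= p a,
      forall a b, p a <= p b + \sum_i rabs (a i - b i) &
      forall t a, p (fun i => t * a i) = rabs t * p a].

Lemma comb_lipschitz_seminorm (V : normedModType K) k (x : 'I_k -> V) :
  (forall i, rnorm (x i) = 1) ->
  lipschitz_seminorm (fun a => rnorm (\sum_i a i *: x i)).
Proof.
move=> x1; split=> [a|a b|t a]; first exact: rnorm_ge0.
  by rewrite -[X in _ + X]mul1r; apply: rnorm_comb_lipschitz => i; rewrite x1.
exact: rnorm_combZ.
Qed.

Section limit.
Context (T : Type) (U : set_system T) (UU : UltraFilter U) (k : nat).
Context (N : T -> ('I_k -> K) -> R) (NS : forall t, lipschitz_seminorm (N t)).

Definition pointwise_ultralimit (p : ('I_k -> K) -> R) : Prop :=
  forall a (eta : R), 0 < eta -> U [set t | `|N t a - p a| < eta].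

Lemma ultralimit_seminorm :
  exists2 p, lipschitz_seminorm p & pointwise_ultralimit p.
Proof.
have UP := @ultra_proper _ _ UU.
have lim a : exists r : R, forall eta : R, 0 < eta -> U [set t | `|N t a - r| < eta].
  apply: (@real_ultralimit _ _ _ _ (N ^~ a) (\sum_i rabs (a i))).
  apply: filterE => t /=; have [N0 NL NZ] := NS t; rewrite ger0_norm//.
  rewrite (le_trans (NL _ (fun i => 0 * a i)))// NZ rabs0 mul0r add0r.
  by apply: ler_sum => i _; rewrite mul0r subr0.
have [p pP] := choice lim; exists p => //; split.
- move=> a; apply: (@ler_forall_gt0 _ _ _ 1) => // eta e0.
  have [t /=] := @filter_ex _ U _ _ (pP a _ e0); have [N0 _ _] := NS t.
  by rewrite ltr_distl => /andP[_ h]; rewrite mul1r (le_trans (N0 a))// ltW.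
- move=> a b; apply: (@ler_forall_gt0 _ _ _ 2) => // eta e0.
  have [t [/=]] := @filter_ex _ U _ _ (filterI (pP a _ e0) (pP b _ e0)).
  have [_ NL _] := NS t; have := NL a b.
  by rewrite !ltr_distl => h /andP[? ?] /andP[? ?]; lra.
- move=> t a; apply/eqP; rewrite -subr_eq0 -normr_le0.
  apply: (@ler_forall_gt0 _ _ _ (1 + rabs t)); first by rewrite addr_ge0// rabs_ge0.
  move=> eta e0.
  have [s [/=]] := @filter_ex _ U _ _ (filterI (pP (fun i => t * a i) _ e0) (pP a _ e0)).
  have [_ _ ->] := NS s => h1 h2.
  rewrite add0r mulrDl mul1r (le_trans (ler_distD (rabs t * N s a) _ _))// lerD//.
    by rewrite distrC ltW.
  by rewrite -mulrBr normrM ger0_norm ?rabs_ge0// ler_wpM2l ?rabs_ge0// ltW.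
Qed.

(* Ultralimits of the coefficients replace the compactness of the unit sphere
   of K^k. *)
Lemma ultralimit_uniform p (theta : R) : lipschitz_seminorm p ->
  pointwise_ultralimit p -> (forall a, p a = 0 -> forall i, a i = 0) ->
  0 < theta -> U [set t | forall a, `|N t a - p a| <= theta * p a].
Proof.
have UP := @ultra_proper _ _ UU.
move=> [p0 pL pZ] pN pI th0.
have [c c0 pc] : exists2 c : R, 0 < c &
    forall a : 'I_k -> K, c * \sum_i rabs (a i) <= p a.
  by apply: (norm_equivalence (C := 1)) => // a b; rewrite mul1r.
set A := [set t | _]; have [//|nA] := in_ultra_setVsetC A UU.
pose far t (a : 'I_k -> K) := \sum_i rabs (a i) = 1 /\ theta * c < `|N t a - p a|.
have bad t : exists a : 'I_k -> K, A t \/ far t a.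
  have [At|At] := pselect (A t); first by exists (fun=> 0); left.
  have [a /negP] : exists a, ~ (`|N t a - p a| <= theta * p a).
    by apply: contrapT => h; apply: At => a /=; apply: contrapT => ha; apply: h; exists a.
  rewrite -ltNge => ha; have [N0 NL NZ] := NS t.
  set s := \sum_i rabs (a i) in pc *.
  have s0 : 0 < s.
    rewrite lt_def rabs_sum_ge0 andbT; apply/eqP => sa0.
    have a0 i : a i = 0 by apply/rabs_eq0/eqP; rewrite eq_le rabs_ge0 -sa0 rabs_sum1.
    move: ha; rewrite (_ : a = (fun i => 0 * a i)); last first.
      by apply/funext => i; rewrite mul0r a0.
    by rewrite NZ pZ rabs0 !mul0r subrr normr0 mulr0 ltxx.
  have rs : rabs (of_real F s^-1) = s^-1 by rewrite rabs_of_real gtr0_norm ?invr_gt0.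
  exists (fun i => of_real F s^-1 * a i); right; split.
    by under eq_bigr do rewrite rabsM rs; rewrite -mulr_sumr mulVf ?gt_eqF.
  rewrite NZ pZ rs -mulrBr normrM gtr0_norm ?invr_gt0// ltr_pdivlMl//.
  rewrite (le_lt_trans _ ha)// mulrC -mulrA ler_wpM2l//; first exact: ltW.
  exact: pc.
have [f fP] := choice bad.
have [|l lP] := @bounded_ultralimit_coef _ _ T U k f 1 UU.
  apply: filterS nA => t nAt i; case: (fP t) => // -[<- _]; exact: rabs_sum1.
have D0 : 0 < 2 * k%:R + 1 :> R by rewrite ltr_wpDl// mulr_ge0.
pose eta := theta * c / (2 * k%:R + 1).
have e0 : 0 < eta by rewrite divr_gt0// mulr_gt0.
have [t [[/= h1 h2] h3]] :=
  @filter_ex _ U _ _ (filterI (filterI (lP _ e0) (pN l _ e0)) nA).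
have [//|[_ ft]] := fP t; exfalso.
have [N0 NL NZ] := NS t.
have sl : \sum_i rabs (f t i - l i) <= k%:R * eta.
  rewrite mulr_natl -[k in _ *+ k]card_ord -sumr_const.
  by apply: ler_sum => i _; exact/ltW.
have sl' : \sum_i rabs (l i - f t i) <= k%:R * eta.
  by under eq_bigr do rewrite rabsBC.
have : eta * (2 * k%:R + 1) = theta * c by rewrite divfK ?gt_eqF.
move: ft h2 (NL (f t) l) (NL l (f t)) (pL (f t) l) (pL l (f t)).
rewrite ltr_distl ltNge => /negP ft /andP[? ?] ? ? ? ? ?; apply: ft.
by rewrite ler_distl; apply/andP; split; lra.
Qed.

End limit.

End ultralimit_norms.

Section categorical.
Context (R : realType) (F : scalar_kind).
Local Notation K := (scalar_field R F).

Lemma ultralimit_spanning (E : normedModType K) n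
    (U : set_system (orbit_space E n)) : UltraFilter U ->
  exists k (f : 'I_k -> 'I_n) p,
  [/\ lipschitz_seminorm p,
      pointwise_ultralimit U
        (fun q a => rnorm (\sum_i a i *: orbit_repr q (f i))) p,
      forall a : 'I_k -> K, p a = 0 -> forall i, a i = 0 &
      forall j, exists beta : 'I_k -> K, forall eta : R, 0 < eta ->
        U [set q | rnorm (orbit_repr q j - \sum_i beta i *: orbit_repr q (f i)) < eta]].
Proof.
move=> UU; have UP := @ultra_proper _ _ UU.
pose N k (f : 'I_k -> 'I_n) (q : orbit_space E n) (a : 'I_k -> K) :=
  rnorm (\sum_i a i *: orbit_repr q (f i)).
have NS k f q : lipschitz_seminorm (@N k f q).
  by apply: comb_lipschitz_seminorm => i; exact: orbit_repr_unit.
pose good k := exists f p, [/\ lipschitz_seminorm p,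
  pointwise_ultralimit U (@N k f) p &
  forall a : 'I_k -> K, p a = 0 -> forall i, a i = 0].
have good0 : exists k, `[< good k >].
  have f : 'I_0 -> 'I_n by case.
  exists 0%N; apply/asboolP; exists f.
  have [p pS pN] := ultralimit_seminorm UU (NS _ f).
  by exists p; split=> // a _ [].
have goodn k : `[< good k >] -> (k <= n)%N.
  move=> /asboolP[f [p [_ pN pI]]].
  rewrite -(card_ord k) -(card_ord n); apply: (@leq_card _ _ f) => i j fij.
  apply/eqP; apply: contrapT => /negP ij.
  pose a (l : 'I_k) : K := (l == i)%:R - (l == j)%:R.
  have : a i = 0.
    apply: pI; apply/eqP; rewrite -normr_le0; apply/ler_addgt0Pl => e e0.
    have [q /=] := @filter_ex _ U _ _ (pN a _ e0).
    rewrite /N; under eq_bigr do rewrite scalerBl.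
    rewrite sumrB !(comb_delta (fun l => orbit_repr q (f l))) fij subrr rnorm0.
    by rewrite sub0r normrN addr0 => /ltW.
  by rewrite /a eqxx (negPf ij) subr0 => /eqP; rewrite oner_eq0.
have [k /asboolP[f [p [pS pN pI]]] kmax] := ex_maxnP good0 goodn.
exists k, f, p; split=> // j.
pose g (i : 'I_k.+1) := if unlift ord0 i is Some i' then f i' else j.
have g0 : g ord0 = j by rewrite /g unlift_none.
have gl i : g (lift ord0 i) = f i by rewrite /g liftK.
have [p' p'S p'N] := ultralimit_seminorm UU (NS _ g).
have [c [p'c [i0 ci0]]] : exists c : 'I_k.+1 -> K, p' c = 0 /\ exists i, c i <> 0.
  apply: contrapT => noc.
  have : `[< good k.+1 >].
    apply/asboolP; exists g, p'; split=> // a pa i; apply: contrapT => ai.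
    by apply: noc; exists a; split=> //; exists i.
  by move=> /kmax; rewrite ltnn.
have NE q : N _ g q c = rnorm (c ord0 *: orbit_repr q j +
    \sum_i c (lift ord0 i) *: orbit_repr q (f i)).
  rewrite /N big_ord_recl g0; congr (rnorm (_ + _)).
  by apply: eq_bigr => i _; rewrite gl.
have Nsmall (eta : R) : 0 < eta -> U [set q | N _ g q c < eta].
  move=> e0; apply: filterS (p'N c _ e0) => q /=.
  by rewrite p'c subr0; apply: le_lt_trans; exact: ler_norm.
have c0 : c ord0 != 0.
  apply: contra_notN ci0 => /eqP c0.
  case: (unliftP ord0 i0) => [i ->|->//].
  apply: (pI (fun i => c (lift ord0 i))); apply/eqP; rewrite -normr_le0.
  apply: (@ler_forall_gt0 _ _ _ 2) => // e e0.
  have [q [/=]] := @filter_ex _ U _ _ (filterI (Nsmall _ e0) (pN (fun i => c (lift ord0 i)) _ e0)).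
  rewrite NE c0 scale0r add0r /N ltr_distl => h1 /andP[h2 h3].
  by rewrite ger0_norm; [lra|case: pS].
have r0 := rabs_gt0 c0.
exists (fun i => - (c ord0)^-1 * c (lift ord0 i)) => eta e0.
apply: filterS (Nsmall _ (mulr_gt0 r0 e0)) => q /=.
rewrite NE -ltr_pdivrMl//; apply: le_lt_trans.
rewrite ler_pdivlMl// -rnormZ scalerBr scaler_sumr -sumrN.
rewrite le_eqVlt; apply/orP; left; apply/eqP; congr (rnorm (_ + _)).
by apply: eq_bigr => i _; rewrite scalerA mulrA mulrN mulfV// mulN1r scaleNr opprK.
Qed.

Lemma fraisse_ultrafilter_cauchy (E : normedModType K) n
    (U : set_system (orbit_space E n)) : fraisse E -> UltraFilter U ->
  forall eps : R, 0 < eps ->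
  exists2 A, U A & forall q q', A q -> A q' -> mdist q q' < eps.
Proof.
move=> frE UU eps eps0; have UP := @ultra_proper _ _ UU.
have [k [f [p [pS pN pI]]]] := ultralimit_spanning UU.
move=> /choice[beta betaP].
pose B := \sum_j \sum_i rabs (beta j i).
have Bj j : \sum_i rabs (beta j i) <= B.
  rewrite /B (bigD1 j)//= lerDl; apply: sumr_ge0 => i _; exact: rabs_sum_ge0.
have B0 : 0 <= B by apply: sumr_ge0 => i _; exact: rabs_sum_ge0.
have n0 : 0 < 3 * n%:R + 1 :> R by rewrite ltr_wpDl// mulr_ge0.
have B1 : 0 < B + 1 by rewrite ltr_wpDl.
pose eta := eps / (3 * n%:R + 1).
have eta0 : 0 < eta by rewrite divr_gt0.
have [delta d0 frd] := frE (eta / (B + 1)) k (divr_gt0 eta0 B1).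
have d2 : 0 < 2 + delta by rewrite addr_gt0.
pose theta := delta / (2 + delta).
have th0 : 0 < theta by rewrite divr_gt0.
have thE : theta * (2 + delta) = delta by rewrite divfK ?gt_eqF.
have th1 : theta < 1 by rewrite ltr_pdivrMr// mul1r ltrDr.
have NS (q : orbit_space E n) :
    lipschitz_seminorm (fun a => rnorm (\sum_i a i *: orbit_repr q (f i))).
  by apply: comb_lipschitz_seminorm => i; exact: orbit_repr_unit.
have unif := ultralimit_uniform UU NS pS pN pI th0.
have span : U [set q | forall j,
    rnorm (orbit_repr q j - \sum_i beta j i *: orbit_repr q (f i)) < eta].
  by apply: filter_forall => j; exact: betaP.
eexists; first exact: (filterI unif span).
move=> q q' [/= qp qs] [q'p q's].
have p0 a : 0 <= p a by case: pS.
pose x i := orbit_repr q (f i); pose y i := orbit_repr q' (f i).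
have pE a : p a + theta * p a = (1 + delta) * (p a - theta * p a).
  have : theta * (2 + delta) * p a = delta * p a by rewrite thE.
  lra.
have xy a : rnorm (\sum_i a i *: y i) <= (1 + delta) * rnorm (\sum_i a i *: x i).
  have := qp a; have := q'p a; rewrite !ler_distl => /andP[_ h1] /andP[h2 _].
  rewrite (le_trans h1)//.
  rewrite pE.
  by rewrite ler_wpM2l// addr_ge0// ltW.
have yx a : rnorm (\sum_i a i *: x i) <= (1 + delta) * rnorm (\sum_i a i *: y i).
  have := qp a; have := q'p a; rewrite !ler_distl => /andP[h2 _] /andP[_ h1].
  rewrite (le_trans h1)//.
  rewrite pE.
  by rewrite ler_wpM2l// addr_ge0// ltW.
have xI : lin_indep x.
  move=> a a0 i; apply: pI; apply/eqP; rewrite eq_le p0 andbT.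
  have : `|rnorm (\sum_i a i *: x i) - p a| <= theta * p a by exact: qp.
  rewrite a0 rnorm0 sub0r normrN ger0_norm// => h.
  by have := p0 a; nra.
have d1 : 0 < 1 + delta by rewrite addr_gt0.
have dV (r : R) : 0 <= r -> (1 + delta)^-1 * r <= r <= (1 + delta) * r.
  by move=> r0; rewrite ler_pdivrMl//; apply/andP; split; nra.
have [psi psiE] := lin_indep_extend y xI.
have Xx : Age_ E k (lin_span x) by exists x.
have id_emb : Emb_ delta (lin_span x) (id : E -> E).
  by split=> // z _; apply: dV; exact: rnorm_ge0.
have psi_emb : Emb_ delta (lin_span x) psi.
  split; first exact: comb_linear_on psiE.
  by move=> _ [a ->]; rewrite psiE ler_pdivrMl// xy yx.
have [T iT Tpsi] := frd _ Xx _ _ id_emb psi_emb.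
have Txy i : rnorm (T (x i) - y i) <= eta / (B + 1).
  have -> : y i = psi (x i) by rewrite -[x i in RHS]comb_delta psiE comb_delta.
  apply: le_trans (ltW Tpsi).
  apply: (@le_opnorm _ _ _ _ _ ((T \o id) \- psi) (2 + delta)).
  - move=> z Xz z1 /=; rewrite (le_trans (ler_rnormD _ _))// rnormN.
    rewrite (proj1 iT); have /andP[_] := proj2 psi_emb _ Xz; have := rnorm_ge0 z; nra.
  - exact: lin_span_mem.
  - by rewrite orbit_repr_unit.
have Tq j : rnorm (T (orbit_repr q j) - orbit_repr q' j) <= 3 * eta.
  pose s := \sum_i beta j i *: x i; pose s' := \sum_i beta j i *: y i.
  have h1 : rnorm (T (orbit_repr q j) - T s) <= eta by rewrite Isom_rnormB// ltW// qs.
  have h2 : rnorm (s' - orbit_repr q' j) <= eta by rewrite rnormBC ltW// q's.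
  have h3 : rnorm (T s - s') <= eta.
    rewrite linear_sum -sumrB; under eq_bigr do rewrite linearZ -scalerBr.
    rewrite (le_trans (ler_rnorm_comb _ Txy))// -mulrA ler_piMr// ?(ltW eta0)//.
    by rewrite mulrC ler_pdivrMr// mul1r (le_trans (Bj j))// lerDl.
  have := ler_rnorm_triangle (T s) (T (orbit_repr q j)) (orbit_repr q' j).
  have := ler_rnorm_triangle s' (T s) (orbit_repr q' j).
  lra.
rewrite mdist_repr (le_lt_trans (orbit_dist_le _ _ iT))//.
rewrite (le_lt_trans (@l2norm_le _ _ _ _ _ (3 * eta) _ _))//.
- by rewrite mulr_ge0// ltW.
- by move=> j; rewrite !ffunE.
have : eta * (3 * n%:R + 1) = eps by rewrite divfK ?gt_eqF.
lra.
Qed.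

Lemma omega_categorical_of_fraisse (E : completeNormedModType K) :
  fraisse E -> omega_categorical E.
Proof.
move=> frE n; rewrite compact_ultra => U UU _; have UP := @ultra_proper _ _ UU.
have pow0 m : 0 < 2^-1 ^+ m :> R by rewrite exprn_gt0.
have /choice[A AP] m : exists A, U A /\ forall q q', A q -> A q' -> mdist q q' < 2^-1 ^+ m :> R.
  by have [A UA AP] := fraisse_ultrafilter_cauchy frE UU (pow0 m); exists A.
have /choice[q qP] m : exists q, A m q /\ A m.+1 q.
  have [q [Aq Aq']] := @filter_ex _ U _ _ (filterI (proj1 (AP m)) (proj1 (AP m.+1))).
  by exists q.
have [|q' q'P] := @orbit_space_geometric_cvg _ _ _ _ q.
  move=> m; rewrite (lt_trans (proj2 (AP m.+1) _ _ (proj2 (qP m)) (proj1 (qP m.+1))))//.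
  by rewrite exprS; have := pow0 m; lra.
exists q'; split=> //= V /nbhs_ballP[/= e e0 eV].
have n1 : 0 < n%:R + 1 :> R by rewrite ltr_wpDl.
have [m me] := exprV2_small (divr_gt0 e0 n1).
apply: filterS (proj1 (AP m)) => s As; apply: eV; rewrite ballEmdist /=.
rewrite (le_lt_trans (metric_triangle _ (q m) _))// (metric_sym q').
have := q'P m; have := proj2 (AP m) _ _ (proj1 (qP m)) As.
move: me; rewrite ltr_pdivlMr//; have := pow0 m; lra.
Qed.

Lemma ultrahomogeneous_of_fraisse (E : normedModType K) :
  fraisse E -> approximately_ultrahomogeneous E.
Proof.
move=> frE X [k _ Xk] eps eps0 phi psi [lphi phiE] [lpsi psiE].
have [delta d0 frd] := frE eps k eps0.
have d1 : 0 < 1 + delta by rewrite addr_gt0.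
have dV (x : E) : (1 + delta)^-1 * rnorm x <= rnorm x <= (1 + delta) * rnorm x.
  by have := rnorm_ge0 x; rewrite ler_pdivrMl// => r0; apply/andP; split; nra.
by apply: (frd X Xk); split=> // x Xx; rewrite ?phiE ?psiE.
Qed.

End categorical.

Theorem theorem5p13 (R : realType) (F : scalar_kind)
  (E : completeNormedModType (scalar_field R F)) :
  fraisse E <-> approximately_ultrahomogeneous E /\ omega_categorical E.
Proof.
split=> [frE|[AuH omega]].
  split; first exact: ultrahomogeneous_of_fraisse.
  exact: omega_categorical_of_fraisse.
exact: fraisse_of_ultrahomogeneous_categorical.
Qed.
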